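(* There exist absolute constants $C > 0$ (sufficiently large) and $c > 0$ (sufficiently small) such that the following holds. Let $t = t(n)$ and $\alpha = \alpha(n)$ be integers with $t \geq \frac{C \log\log n}{\log\log\log n}$, $0 \leq \alpha < c\, t \log t$ and $\alpha = o(n)$. Then for every sufficiently large $n$, Client has a winning strategy for the $(1:q)$ Waiter-Client game $(E(K_n), \mathcal{M}_t)$ for every integer $q \geq n - \alpha$; that is, Client can ensure that at the end of the game his graph does not admit a $K_t$-minor.
   Context: $\log$ denotes the natural logarithm. The $(1:q)$ Waiter-Client game $(X,\mathcal{F})$ with board $X = E(K_n)$ and family of winning sets $\mathcal{F}$ is played as follows: in each round Waiter offers Client $q+1$ previously unoffered elements of $X$; Client claims one of them and Waiter claims the remaining $q$. If in the final round only $1 \le r < q+1$ free elements remain, Client claims $\max\{0, r-q\}$ of them and Waiter claims the rest. Waiter wins if at the end Client has claimed all elements of some $A \in \mathcal{F}$; otherwise Client wins. $\mathcal{M}_t$ is the family of edge sets of all subgraphs of $K_n$ that admit a $K_t$-minor. A graph $G$ admits a $K_t$-minor if there exist pairwise disjoint vertex sets $B_1,\dots,B_t \subseteq V(G)$ such that each $G[B_i]$ is connected and for every $i<j$ there is an edge of $G$ between $B_i$ and $B_j$. *)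

(* Defs.v *)
From mathcomp Require Import all_boot.

Set Implicit Arguments.
Unset Strict Implicit.
Unset Printing Implicit Defensive.

Section WaiterClientGame.
Variables (T : finType) (X : {set T}) (F : {set {set T}}) (q : nat).

(* The completed full rounds in chronological order: the pair (O, x) records
   that Waiter offered O, Client claimed x and Waiter claimed O :\ x. *)
Definition history := seq ({set T} * T).

Definition free_elements (h : history) : {set T} :=
  X :\: \bigcup_(r <- h) r.1.

Definition client_claimed (h : history) : {set T} :=
  [set x in [seq r.2 | r <- h]].

Definition client_strategy := history -> {set T} -> T.

Definition legal_strategy (s : client_strategy) : Prop :=
  forall (h : history) (O : {set T}), O != set0 -> s h O \in O.

Inductive consistent_play (s : client_strategy) : history -> Prop :=
| play_start : consistent_play s [::]
| play_round (h : history) (O : {set T}) :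
    consistent_play s h -> O \subset free_elements h -> #|O| = q.+1 ->
    consistent_play s (rcons h (O, s h O)).

(* When r < q + 1 elements are left, Client claims max(0, r - q) = 0 of them
   and Waiter claims the rest, so Client's final set is client_claimed h. *)
Definition game_over (h : history) : Prop := #|free_elements h| < q.+1.

Definition waiter_wins (h : history) : Prop :=
  exists2 A, A \in F & A \subset client_claimed h.

Definition client_has_winning_strategy : Prop :=
  exists s : client_strategy, legal_strategy s /\
    forall h, consistent_play s h -> game_over h -> ~ waiter_wins h.

End WaiterClientGame.

(* E(K_n): an edge is a two-element set of vertices. *)
Definition complete_edges (n : nat) : {set {set 'I_n}} :=
  [set e : {set 'I_n} | #|e| == 2].

Section Minors.
Variable V : finType.

Definition induced_adj (E : {set {set V}}) (B : {set V}) : rel V :=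
  [rel x y | [&& x \in B, y \in B & [set x; y] \in E]].

(* The empty graph is not connected. *)
Definition induces_connected (E : {set {set V}}) (B : {set V}) : bool :=
  (B != set0) && [forall x in B, forall y in B, connect (induced_adj E B) x y].

Definition edge_between (E : {set {set V}}) (A B : {set V}) : bool :=
  [exists x in A, exists y in B, [set x; y] \in E].

(* The graph with vertex set S and edge set E has a K_t-minor with branch sets
   B i, i < t. *)
Definition admits_complete_minor (S : {set V}) (E : {set {set V}}) (t : nat)
    : bool :=
  [exists B : {ffun 'I_t -> {set V}},
    [&& [forall i, B i \subset S],
        [forall i, forall j, (i != j) ==> [disjoint B i & B j]],
        [forall i, induces_connected E (B i)] &
        [forall i : 'I_t, forall j : 'I_t,
           (i < j) ==> edge_between E (B i) (B j)]]].

End Minors.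

Definition subgraph_complete (n : nat) (S : {set 'I_n}) (E : {set {set 'I_n}})
    : bool :=
  (E \subset complete_edges n) && [forall e in E, e \subset S].

(* M_t: isolated vertices are accounted for by the choice of S. *)
Definition minor_family (n t : nat) : {set {set {set 'I_n}}} :=
  [set E : {set {set 'I_n}} |
    [exists S : {set 'I_n},
       subgraph_complete S E && admits_complete_minor S E t]].

(* Main.v *)
(* Client plays so as to have few cycles. If he chose uniformly at random, the
   expected number of his cycles would be at most the sum over 3 <= l <= n of
   (n / (q + 1))^l / l, that is at most e^(2 alpha) log n; minimizing the
   conditional expectation in each round, he never has more cycles than that.
   On the other hand a K_t-minor yields (t - 2)! cycles through a common vertex,
   one for each order in which the other t - 2 branch sets can be visited
   between two fixed ones, and log (t - 2)! exceeds log log n + 2 alpha. *)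

From mathcomp Require Import all_classical all_reals all_analysis.
Require Import Defs.
From mathcomp Require Import all_boot all_order all_algebra.
From mathcomp Require Import zify ring lra.

Set Implicit Arguments.
Unset Strict Implicit.
Unset Printing Implicit Defensive.

Import Order.TTheory GRing.Theory Num.Theory.
Import numFieldNormedType.Exports.

Local Open Scope ring_scope.

Lemma ler_sum_uniq_sub (R : numDomainType) (I : eqType) (F : I -> R)
    (r s : seq I) : (forall i, 0 <= F i) -> uniq r -> {subset r <= s} ->
  \sum_(i <- r) F i <= \sum_(i <- s) F i.
Proof.
move=> F_ge0; elim: r s => [|i r IH] s; first by rewrite big_nil sumr_ge0.
move=> /andP[i_notin_r uniq_r] sub_s.
rewrite big_cons [leRHS](big_rem i) ?sub_s ?mem_head //= lerD2l.
apply: IH => // j j_in_r; rewrite rem_mem ?sub_s ?inE ?j_in_r ?orbT //.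
by apply: contraNneq i_notin_r => <-.
Qed.

Section ClientStrategies.
Variables (T : finType) (X : {set T}) (q : nat).
Implicit Types (A O : {set T}) (h : history T).

Lemma client_claimed_nil : client_claimed [::] = set0 :> {set T}.
Proof. by apply/setP => x; rewrite !inE. Qed.

Lemma client_claimed_rcons h O x :
  client_claimed (rcons h (O, x)) = x |: client_claimed h.
Proof. by apply/setP => z; rewrite !inE map_rcons mem_rcons inE. Qed.

Lemma free_elements_rcons h O x :
  free_elements X (rcons h (O, x)) = free_elements X h :\: O.
Proof. by rewrite /free_elements -cats1 big_cat big_seq1 /= setDDl. Qed.

(* The method of conditional expectations: Client minimizes the potential. *)
Lemma client_strategy_noninc (R : realDomainType) (x0 : T)
    (potential : history T -> R) :
  (forall h O, O \subset free_elements X h -> #|O| = q.+1 ->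
    \sum_(x in O) potential (rcons h (O, x)) <= q.+1%:R * potential h) ->
  exists2 s : client_strategy T, legal_strategy s &
    forall h, consistent_play X q s h -> potential h <= potential [::].
Proof.
move=> average_le; pose s h O := if [pick x in O] is Some y
  then [arg min_(x < y in O) potential (rcons h (O, x))]%O else x0.
have sP h O : O != set0 -> s h O \in O /\ forall x, x \in O ->
    potential (rcons h (O, s h O)) <= potential (rcons h (O, x)).
  move=> /set0Pn[y yO]; rewrite /s.
  case: pickP => [z zO|/(_ y)]; last by rewrite yO.
  by case: (arg_minP (fun x => potential (rcons h (O, x))) zO).
exists s => [h O /(sP h)[] //|h]; elim=> // {}h O _ IH O_free cardO.
apply: le_trans IH; have [|_ s_min] := sP h O; first by rewrite -card_gt0 cardO.
rewrite -(ler_pM2l (_ : 0 < q.+1%:R)) ?ltr0n //.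
apply: le_trans (average_le h O O_free cardO).
by rewrite mulr_natl -{1}cardO -sumr_const; apply: ler_sum.
Qed.

Section ClaimWeight.
Variable R : realFieldType.

Definition claimable A h := A \subset client_claimed h :|: free_elements X h.

(* An upper bound for the conditional probability that Client claims all of A
   if he makes the remaining choices uniformly at random. *)
Definition claim_weight A h : R :=
  (claimable A h)%:R / q.+1%:R ^+ #|A :\: client_claimed h|.

Lemma claim_weight_ge0 A h : 0 <= claim_weight A h.
Proof. by rewrite divr_ge0 ?exprn_ge0. Qed.

Lemma claim_weight_claimed A h : A \subset client_claimed h ->
  claim_weight A h = 1.
Proof.
move=> A_claimed; rewrite /claim_weight /claimable.
rewrite (subset_trans A_claimed (subsetUl _ _)).
by move: A_claimed; rewrite -setD_eq0 => /eqP->; rewrite cards0 expr0 divr1.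
Qed.

Lemma claim_weight_nil A : claim_weight A [::] <= (q.+1%:R ^+ #|A|)^-1.
Proof.
rewrite /claim_weight client_claimed_nil setD0 ler_piMl ?invr_ge0 ?exprn_ge0 //.
by rewrite lern1 leq_b1.
Qed.

Lemma claimable_rcons_le A h O x : O \subset free_elements X h -> x \in O ->
  (claimable A (rcons h (O, x)) <= claimable A h)%N.
Proof.
rewrite /claimable client_claimed_rcons free_elements_rcons => O_free xO.
case: (boolP (A \subset _)) => // /subset_trans-> //.
rewrite -setUA subUset sub1set in_setU.
by rewrite (subsetP O_free) ?orbT //= setUS ?subsetDl.
Qed.

Lemma claim_weight_rcons_claim A h O x :
  O \subset free_elements X h -> x \in O -> x \in A :\: client_claimed h ->
  claim_weight A (rcons h (O, x)) <= q.+1%:R * claim_weight A h.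
Proof.
move=> O_free xO xA; rewrite /claim_weight client_claimed_rcons.
rewrite setUC -setDDl (cardsD1 x (A :\: client_claimed h)) xA exprS invfM.
rewrite mulrCA mulVKf ?pnatr_eq0 // ler_wpM2r ?invr_ge0 ?exprn_ge0 //.
by rewrite ler_nat claimable_rcons_le.
Qed.

Lemma claim_weight_rcons_ignore A h O x :
  O \subset free_elements X h -> x \in O -> x \notin A :\: client_claimed h ->
  claim_weight A (rcons h (O, x)) <= claim_weight A h.
Proof.
move=> O_free xO xA; rewrite /claim_weight client_claimed_rcons.
rewrite setUC -setDDl (_ : _ :\: [set x] = A :\: client_claimed h); last first.
  by apply/setDidPl; rewrite disjoint_sym disjoints1.
rewrite ler_wpM2r ?invr_ge0 ?exprn_ge0 //.
by rewrite ler_nat claimable_rcons_le.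
Qed.

Lemma claim_weight_rcons_lose A h O x z :
  z \in A :\: client_claimed h -> z \in O -> x != z ->
  claim_weight A (rcons h (O, x)) = 0.
Proof.
rewrite in_setD => /andP[z_unclaimed zA] zO xz; rewrite /claim_weight.
suff /negPf-> : ~~ claimable A (rcons h (O, x)) by rewrite mul0r.
apply/subsetPn; exists z => //.
rewrite client_claimed_rcons free_elements_rcons.
by rewrite in_setU in_setU1 in_setD zO orbF negb_or eq_sym xz.
Qed.

Lemma sum_claim_weight_rcons A h O :
  O \subset free_elements X h -> #|O| = q.+1 ->
  \sum_(x in O) claim_weight A (rcons h (O, x)) <= q.+1%:R * claim_weight A h.
Proof.
move=> O_free cardO.
have [AO0|[z /setIP[zA zO]]] := set_0Vmem ((A :\: client_claimed h) :&: O).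
  rewrite mulr_natl -cardO -sumr_const; apply: ler_sum => x xO.
  apply: claim_weight_rcons_ignore => //; apply/negP => xA.
  by move/setP/(_ x): AO0; rewrite in_set0 in_setI xA xO.
rewrite (bigD1 z) //= big1 ?addr0 => [|x /andP[_]].
  exact: claim_weight_rcons_claim.
exact: claim_weight_rcons_lose.
Qed.

Lemma client_strategy_claimed_le (x0 : T) (I : Type) (r : seq I) (w : I -> R)
    (A : I -> {set T}) : (forall i, 0 <= w i) ->
  exists2 s : client_strategy T, legal_strategy s &
    forall h, consistent_play X q s h ->
      \sum_(i <- r | A i \subset client_claimed h) w i
        <= \sum_(i <- r) w i / q.+1%:R ^+ #|A i|.
Proof.
move=> w_ge0; pose potential h := \sum_(i <- r) w i * claim_weight (A i) h.
have [|s s_legal potential_le] := @client_strategy_noninc _ x0 potential.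
  move=> h O O_free cardO; rewrite exchange_big mulr_sumr /=.
  apply: ler_sum => i _.
  by rewrite -mulr_sumr mulrCA ler_wpM2l ?sum_claim_weight_rcons.
exists s => // h /potential_le potential_h.
apply: (@le_trans _ _ (potential h)).
  rewrite big_mkcond; apply: ler_sum => i _.
  case: ifP => [/claim_weight_claimed->|_]; first by rewrite mulr1.
  by rewrite mulr_ge0 ?claim_weight_ge0.
apply: le_trans potential_h _; apply: ler_sum => i _.
by rewrite ler_wpM2l ?claim_weight_nil.
Qed.

End ClaimWeight.

End ClientStrategies.

Section Rotations.
Variable T : eqType.
Implicit Types (x : T) (p c : seq T).

Lemma index_rot_cons x p i : x \notin p -> (i <= size p)%N ->
  index x (rot i (x :: p)) = if i == 0%N then 0%N else ((size p).+1 - i)%N.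
Proof.
case: i => [|i] x_notin_p i_lt; first by rewrite rot0 /= eqxx.
have /negPf x_notin_drop : x \notin drop i p.
  by apply: contra x_notin_p; apply: mem_drop.
by rewrite /rot /= index_cat x_notin_drop size_drop /= eqxx addn0 subSS.
Qed.

Lemma rot_cons_inj x p p' i j : x \notin p -> x \notin p' ->
  (i <= size p)%N -> (j <= size p')%N -> rot i (x :: p) = rot j (x :: p') ->
  i = j /\ p = p'.
Proof.
move=> xp xp' i_le j_le eq_rot.
have eq_size : size p = size p'.
  by have := congr1 size eq_rot; rewrite !size_rot => -[].
have eq_ij : i = j.
  have := congr1 (index x) eq_rot; rewrite !index_rot_cons //.
  by case: eqP; case: eqP; lia.
by move: eq_rot; rewrite eq_ij => /rot_inj[].
Qed.

Lemma uniq_rotations x (cs : seq (seq T)) : uniq cs ->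
  {in cs, forall c, uniq c /\ ohead c = Some x} ->
  uniq [seq rot i c | c <- cs, i <- iota 0 (size c)].
Proof.
move=> uniq_cs cs_x; apply: allpairs_uniq_dep => // [c _|].
  exact: iota_uniq.
move=> _ _ /allpairsPdep[c [i [c_cs + ->]]] /allpairsPdep[d [j [d_cs + ->]]] /=.
rewrite !mem_iota !add0n /=.
have [] := cs_x c c_cs; have [] := cs_x d d_cs.
case: c d {c_cs d_cs} => [|? p] [|? p'] //= /andP[xp' _] [eq_x].
rewrite eq_x in xp' *; move=> /andP[xp _] [eq_x']; rewrite eq_x' in xp *.
by move=> i_lt j_lt /(rot_cons_inj xp xp' i_lt j_lt)[-> ->].
Qed.

End Rotations.

Lemma next_next_neq (T : eqType) (c : seq T) x :
  uniq c -> (2 < size c)%N -> x \in c -> next c (next c x) != x.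
Proof.
move=> uniq_c size_c /rot_to[i p rot_c]; rewrite -!(next_rot i uniq_c) rot_c.
have : uniq (rot i c) by rewrite rot_uniq.
have : (2 < size (rot i c))%N by rewrite size_rot.
rewrite rot_c; case: p {rot_c} => [|a [|b p]] //= _.
rewrite !inE !negb_or !eqxx => /andP[/and3P[/negPf xa /negPf xb _] _].
by rewrite [a == x]eq_sym xa eq_sym xb.
Qed.

Section Cycles.
Variable V : finType.
Implicit Types (c : seq V) (E : {set {set V}}) (y : V).

Definition adj E : rel V := [rel x y | [set x; y] \in E].

Definition cycle_edges c : {set {set V}} := [set [set x; next c x] | x in c].

Lemma cycle_edges_sub c E : uniq c ->
  (cycle_edges c \subset E) = cycle (adj E) c.
Proof.
move=> uniq_c; apply/subsetP/idP => [edges_sub|cycle_c _ /imsetP[x xc ->]].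
  by apply: (cycle_from_next uniq_c) => x xc; apply: edges_sub; apply: imset_f.
exact: (next_cycle cycle_c xc).
Qed.

Lemma card_cycle_edges c : uniq c -> (2 < size c)%N ->
  #|cycle_edges c| = size c.
Proof.
move=> uniq_c size_c; rewrite card_in_imset ?(card_uniqP uniq_c) //.
move=> x y xc yc; have [//|xy] := eqVneq x y => eq_edges.
have x_next : x = next c y.
  by have := set21 x (next c x); rewrite eq_edges !inE (negPf xy) => /eqP.
have y_next : y = next c x.
  have := set21 y (next c y); rewrite -eq_edges !inE eq_sym (negPf xy).
  by move/eqP.
by have := next_next_neq uniq_c size_c xc; rewrite -y_next -x_next eqxx.
Qed.

(* Every cycle of length l is listed l times in each of its two directions. *)
Definition all_cycles : seq (seq V) :=
  [seq c <- [seq tval u | l <- index_iota 3 #|V|.+1, u <- enum {: l.-tuple V}]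
    | uniq c].

Lemma mem_all_cycles c : (c \in all_cycles) = uniq c && (2 < size c)%N.
Proof.
rewrite mem_filter; have [uniq_c /=|//] := boolP (uniq c).
apply/allpairsPdep/idP => [[l [u [+ _ ->]]]|size_c].
  by rewrite mem_index_iota size_tuple => /andP[].
exists (size c), (in_tuple c); split; rewrite ?mem_enum //.
by rewrite mem_index_iota size_c ltnS -(card_uniqP uniq_c) max_card.
Qed.

Lemma all_cycles_uniq : uniq all_cycles.
Proof.
apply/filter_uniq/allpairs_uniq_dep => [|l _|].
- exact: iota_uniq.
- exact: enum_uniq.
move=> [l u] [l' u'] _ _ /= eq_u.
have eq_l : l = l' by rewrite -(size_tuple u) eq_u size_tuple.
by case: _ / eq_l in u' eq_u *; rewrite (val_inj eq_u).
Qed.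

Definition cycles E := [seq c <- all_cycles | cycle (adj E) c].

Lemma mem_cycles E c :
  (c \in cycles E) = [&& uniq c, (2 < size c)%N & cycle (adj E) c].
Proof. by rewrite mem_filter mem_all_cycles andbC andbA. Qed.

Definition cycles_from E y := [seq c <- cycles E | ohead c == Some y].

Section CycleCount.
Variable R : realFieldType.

(* The weights compensate for the repetitions in [all_cycles], so this is twice
   the number of cycles of the graph E. *)
Definition cycle_count E : R := \sum_(c <- cycles E) (size c)%:R^-1.

Lemma cycle_countE E : cycle_count E =
  \sum_(c <- all_cycles | cycle_edges c \subset E) (size c)%:R^-1.
Proof.
rewrite /cycle_count big_filter big_seq_cond [RHS]big_seq_cond.
apply: eq_bigl => c; rewrite mem_all_cycles.
by case: (boolP (uniq c)) => //= /cycle_edges_sub->.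
Qed.

Lemma cycle_count_sub E E' : E \subset E' -> cycle_count E <= cycle_count E'.
Proof.
move=> /subsetP E_sub; apply: ler_sum_uniq_sub => [c||c].
- by rewrite invr_ge0.
- exact/filter_uniq/all_cycles_uniq.
- rewrite !mem_filter => /andP[cycle_c ->]; rewrite andbT.
  by apply: sub_cycle cycle_c => x y /E_sub.
Qed.

Lemma size_cycles_from_le E y : (size (cycles_from E y))%:R <= cycle_count E.
Proof.
pose rots := [seq rot i c | c <- cycles_from E y, i <- iota 0 (size c)].
have -> : (size (cycles_from E y))%:R = \sum_(c <- rots) (size c)%:R^-1 :> R.
  rewrite big_allpairs_dep -sum1_size natr_sum big_seq [RHS]big_seq.
  apply: eq_bigr => c; rewrite mem_filter mem_cycles => /and4P[_ _ size_c _].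
  under eq_bigr do rewrite size_rot.
  rewrite big_const_seq count_predT size_iota iter_addr addr0.
  by rewrite -[_^-1 *+ _]mulr_natr mulVf // pnatr_eq0; lia.
apply: ler_sum_uniq_sub => [c||_ /allpairsPdep[c [i [+ _ ->]]]].
- by rewrite invr_ge0.
- apply: (@uniq_rotations _ y) => [|c].
    exact/filter_uniq/filter_uniq/all_cycles_uniq.
  by rewrite mem_filter mem_cycles => /andP[/eqP-> /andP[->]].
- by rewrite mem_filter !mem_cycles rot_uniq size_rot rot_cycle => /andP[].
Qed.

Lemma sum_all_cycles_le (x : R) : 0 <= x ->
  \sum_(c <- all_cycles) (size c)%:R^-1 * x ^+ #|cycle_edges c|
    <= \sum_(3 <= l < #|V|.+1) l%:R^-1 * (#|V|%:R * x) ^+ l.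
Proof.
move=> x_ge0; rewrite big_filter big_mkcond big_allpairs_dep.
rewrite big_nat_cond [leRHS]big_nat_cond.
apply: ler_sum => l /andP[/andP[l_gt2 _] _].
apply: (@le_trans _ _ (\sum_(u <- enum {: l.-tuple V}) l%:R^-1 * x ^+ l)).
  apply: ler_sum => u _; case: ifP => [uniq_u|_].
    by rewrite card_cycle_edges ?size_tuple.
  by rewrite mulr_ge0 ?invr_ge0 ?exprn_ge0.
rewrite big_enum /= sumr_const card_tuple exprMn -natrX.
by rewrite mulr_natl mulrnAr.
Qed.

Lemma client_strategy_cycle_count_le (X : {set {set V}}) (q : nat) :
  exists2 s : client_strategy {set V}, legal_strategy s &
    forall h, consistent_play X q s h ->
      cycle_count (client_claimed h)
        <= \sum_(3 <= l < #|V|.+1) l%:R^-1 * (#|V|%:R / q.+1%:R) ^+ l.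
Proof.
have [c|s s_legal count_le] := client_strategy_claimed_le X q set0 all_cycles
  cycle_edges (_ : forall c, 0 <= (size c)%:R^-1 :> R).
  by rewrite invr_ge0.
exists s => // h /count_le {}count_le.
apply: le_trans (sum_all_cycles_le (_ : 0 <= q.+1%:R^-1)); last first.
  by rewrite invr_ge0.
under eq_bigr do rewrite exprVn.
by rewrite cycle_countE.
Qed.

End CycleCount.

End Cycles.

Lemma undup_nseq_cat (T : eqType) m (x : T) s : x \notin s ->
  undup (nseq m.+1 x ++ s) = x :: undup s.
Proof.
move=> x_notin_s; elim: m => [|m <-]; first by rewrite /= (negPf x_notin_s).
by rewrite [LHS]/= mem_head.
Qed.

Lemma induces_connected_path (V : finType) (E : {set {set V}}) (A : {set V})
    (a b : V) :
  induces_connected E A -> a \in A -> b \in A ->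
  exists p, [/\ path (adj E) a p, last a p = b, uniq (a :: p) &
    {subset a :: p <= A}].
Proof.
move=> /andP[_ /forall_inP connA] aA bA.
have /forall_inP/(_ b bA)/connectP[p0 + ->] := connA a aA.
case/shortenP=> p path_p uniq_p _; exists p; split=> //.
  by apply: sub_path path_p => x y /and3P[].
move=> x; rewrite inE => /predU1P[-> //|].
elim: p a aA path_p {uniq_p} => //= z p IH a aA /andP[/and3P[_ zA _] path_p].
by rewrite inE => /predU1P[-> //|]; apply: IH path_p.
Qed.

Lemma edge_betweenC (V : finType) (E : {set {set V}}) (A B : {set V}) :
  edge_between E A B = edge_between E B A.
Proof.
apply/exists_inP/exists_inP => -[x xA /exists_inP[y yB xyE]];
  by exists y => //; apply/exists_inP; exists x; rewrite // setUC.
Qed.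

Section BranchSets.
Variables (V I : finType) (E : {set {set V}}) (B : I -> {set V}).
Hypothesis disjB : forall i j, i != j -> [disjoint B i & B j].
Hypothesis connB : forall i, induces_connected E (B i).
Hypothesis edgeB : forall i j, i != j -> edge_between E (B i) (B j).

Definition branch_index (x : V) : option I := [pick i | x \in B i].

Definition itinerary (p : seq V) : seq I := undup (pmap branch_index p).

Lemma branch_index_mem i x : x \in B i -> branch_index x = Some i.
Proof.
move=> x_i; rewrite /branch_index.
case: pickP => [j x_j|/(_ i)]; last by rewrite x_i.
congr Some; apply/eqP; apply: contraT => /disjB/disjoint_setI0/setP/(_ x).
by rewrite !inE x_i x_j.
Qed.

Lemma pmap_branch_index i p : {subset p <= B i} ->
  pmap branch_index p = nseq (size p) i.
Proof.
elim: p => //= x p IH p_i; rewrite (branch_index_mem (p_i x (mem_head _ _))) /=.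
by rewrite IH // => z zp; rewrite p_i // inE zp orbT.
Qed.

Lemma mem_itinerary i x p : x \in B i -> x \in p -> i \in itinerary p.
Proof.
move=> /branch_index_mem x_i xp; rewrite mem_undup mem_pmap -x_i.
exact: map_f.
Qed.

Lemma size_itinerary p : (size (itinerary p) <= size p)%N.
Proof. by rewrite (leq_trans (size_undup _)) // size_pmap count_size. Qed.

Lemma itinerary_segment_cat i x p p' : {subset x :: p <= B i} ->
  i \notin itinerary p' -> itinerary (x :: p ++ p') = i :: itinerary p'.
Proof.
rewrite mem_undup /itinerary -cat_cons pmap_cat => /pmap_branch_index->.
exact: undup_nseq_cat.
Qed.

Lemma branch_path l i a b : uniq (i :: l) -> a \in B i -> b \in B (last i l) ->
  exists p, [/\ path (adj E) a p, last a p = b, uniq (a :: p) &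
    itinerary (a :: p) = i :: l].
Proof.
elim: l i a => [|j l IH] i a.
  move=> _ a_i b_i.
  have [p [? ? ? p_i]] := induces_connected_path (connB i) a_i b_i.
  by exists p; split=> //; rewrite -[p]cats0 (itinerary_segment_cat p_i).
rewrite cons_uniq => /andP[i_notin uniq_jl] a_i b_last.
have ij : i != j by move: i_notin; rewrite inE negb_or => /andP[].
have /exists_inP[u u_i /exists_inP[w w_j uw]] := edgeB ij.
have [p [path_p last_p uniq_p p_i]] := induces_connected_path (connB i) a_i u_i.
have [p' [path_p' last_p' uniq_p' itinerary_p']] := IH j w uniq_jl w_j b_last.
exists (p ++ w :: p'); split.
- by rewrite cat_path last_p path_p /= path_p' andbT.
- by rewrite last_cat.
- rewrite -cat_cons cat_uniq uniq_p uniq_p' andbT; apply/hasPn => x x_p'.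
  apply: contra i_notin => /p_i x_i; rewrite -itinerary_p'.
  exact: mem_itinerary x_p'.
- by rewrite (itinerary_segment_cat p_i) itinerary_p'.
Qed.

Lemma branch_cycles (i j : I) : i != j -> (2 < #|I|)%N ->
  exists y, ((#|I| - 2)`! <= size (cycles_from E y))%N.
Proof.
move=> ij card_I; have /exists_inP[x x_i /exists_inP[y y_j xy]] := edgeB ij.
pose others := enum (~: [set i; j]); pose tour l := j :: rcons l i.
have size_others : size others = (#|I| - 2)%N.
  by rewrite -cardE cardsCs setCK cards2 ij.
exists y; rewrite -size_others -size_permutations ?enum_uniq //.
rewrite -(size_map tour) -(size_map itinerary); apply: uniq_leq_size.
  rewrite map_inj_uniq ?permutations_uniq // => l l' [].
  exact: rcons_injl.
move=> _ /mapP[l + ->]; rewrite mem_permutations => perm_l.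
have uniq_tour : uniq (tour l).
  rewrite /= mem_rcons rcons_uniq inE !(perm_mem perm_l) (perm_uniq perm_l).
  by rewrite !mem_enum !inE !eqxx orbT eq_sym (negPf ij) enum_uniq.
have x_last : x \in B (last j (rcons l i)) by rewrite last_rcons.
have [p [path_p last_p uniq_p itinerary_p]] := branch_path uniq_tour y_j x_last.
apply/mapP; exists (y :: p) => //; rewrite mem_filter eqxx mem_cycles uniq_p.
rewrite (leq_trans _ (size_itinerary _)) ?itinerary_p /=; last first.
  by rewrite size_rcons (perm_size perm_l) size_others; lia.
by rewrite rcons_path path_p last_p.
Qed.

End BranchSets.

Lemma complete_minor_cycle_count_ge (R : realFieldType) (V : finType)
    (S : {set V}) (E : {set {set V}}) t :
  (2 < t)%N -> admits_complete_minor S E t -> (t - 2)`!%:R <= cycle_count R E.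
Proof.
move=> t_gt2 /existsP[B /and4P[_]].
move=> /'forall_'forall_implyP disjB /forallP connB.
move=> /'forall_'forall_implyP edgeB.
have edgeB_sym i j : i != j -> edge_between E (B i) (B j).
  by rewrite neq_ltn => /orP[/edgeB|/edgeB]; rewrite // edge_betweenC.
pose i : 'I_t := Ordinal (ltnW (ltnW t_gt2)).
pose j : 'I_t := Ordinal (ltnW t_gt2).
have [||y] := branch_cycles disjB connB edgeB_sym (i := i) (j := j) => //.
  by rewrite card_ord.
rewrite card_ord -(ler_nat R) => /le_trans; apply.
exact: size_cycles_from_le.
Qed.

Lemma client_avoids_complete_minor (R : realFieldType) (n t q : nat) :
  (2 < t)%N ->
  \sum_(3 <= l < n.+1) l%:R^-1 * (n%:R / q.+1%:R) ^+ l < (t - 2)`!%:R :> R ->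
  client_has_winning_strategy (complete_edges n) (minor_family n t) q.
Proof.
move=> t_gt2 sum_lt.
have [s s_legal count_le] :=
  client_strategy_cycle_count_le R (complete_edges n) q.
exists s; split=> // h /count_le {}count_le _ [A].
rewrite inE => /existsP[S /andP[_ minorA]] A_claimed.
rewrite card_ord in count_le; have := le_lt_trans count_le sum_lt.
apply/negP; rewrite -leNgt.
apply: le_trans (complete_minor_cycle_count_ge _ t_gt2 minorA) _.
exact: cycle_count_sub.
Qed.

Section LogarithmicBounds.
Variable R : realType.
Implicit Types x y : R.

Lemma ln_succ_sub_ge n : (0 < n)%N -> n.+1%:R^-1 <= ln n.+1%:R - ln n%:R :> R.
Proof.
move=> n_gt0; have nR_gt0 : 0 < n%:R :> R by rewrite ltr0n.
have nS_gt0 : 0 < n.+1%:R :> R by rewrite ltr0n.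
rewrite -[leRHS]opprB lerNr -ln_div ?posrE //.
have -> : n%:R / n.+1%:R = 1 - n.+1%:R^-1 :> R.
  by rewrite -natr1 in nS_gt0 *; field; rewrite lt0r_neq0.
by rewrite le_ln1Dx // ltrN2 invf_lt1 // ltr1n ltnS.
Qed.

Lemma sum_inv_le_ln m n : (0 < m <= n)%N ->
  \sum_(m.+1 <= l < n.+1) l%:R^-1 <= ln n%:R - ln m%:R :> R.
Proof.
case/andP=> m_gt0 m_le_n.
rewrite -(telescope_sumr (fun k => ln k%:R)) // big_add1.
apply: ler_sum_nat => l /andP[m_le_l _].
exact/ln_succ_sub_ge/(leq_trans m_gt0).
Qed.

Lemma ln_fact_ge n : n%:R * (ln n%:R - 1) <= ln n`!%:R :> R.
Proof.
case: n => [|n]; first by rewrite mul0r fact0 ln1.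
have fact_gt0R : 0 < n.+1`!%:R :> R by rewrite ltr0n fact_gt0.
have pow_le : n.+1%:R ^+ n.+1 <= expR n.+1%:R * n.+1`!%:R :> R.
  rewrite -ler_pdivrMr //.
  by apply: le_trans (expR_ge1Dxn n (ler0n R n.+1)); rewrite lerDr.
have : ln (n.+1%:R ^+ n.+1) <= ln (expR n.+1%:R * n.+1`!%:R) :> R.
  by rewrite ler_ln ?posrE ?mulr_gt0 ?expR_gt0 ?exprn_gt0 ?ltr0n ?fact_gt0.
rewrite lnXn ?ltr0n // lnM ?posrE ?expR_gt0 // expRK -mulr_natl; lra.
Qed.

Lemma exprn_ratio_le (n a q l : nat) : (a.*2 <= n)%N -> (n <= q + a)%N ->
  (l <= n)%N -> (n%:R / q.+1%:R) ^+ l <= expR (2 * a%:R) :> R.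
Proof.
move=> a_le n_le l_le; have [n0|n_gt0] := posnP n.
  move: l_le; rewrite n0 leqn0 => /eqP->.
  by rewrite expr0 -expR0 ler_expR mulr_ge0.
have nR_gt0 : 0 < n%:R :> R by rewrite ltr0n.
have ratio_le : n%:R / q.+1%:R <= expR (2 * a%:R / n%:R) :> R.
  apply: le_trans (expR_ge1Dx _); rewrite ler_pdivrMr ?ltr0n // -natr1.
  have -> : 1 + 2 * a%:R / n%:R = (n%:R + 2 * a%:R) / n%:R :> R.
    by field; rewrite lt0r_neq0.
  rewrite mulrAC ler_pdivlMr //.
  have aR_ge0 : 0 <= a%:R :> R by [].
  have aR_le : 2 * a%:R <= n%:R :> R by rewrite -natrM ler_nat mul2n.
  have nR_le : n%:R <= q%:R + a%:R :> R by rewrite -natrD ler_nat.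
  by nra.
apply: (@le_trans _ _ (expR (2 * a%:R / n%:R) ^+ l)).
  by rewrite lerXn2r ?nnegrE ?expR_ge0 ?divr_ge0.
rewrite -expRM_natl ler_expR mulrA ler_pdivrMr // [leLHS]mulrC.
by rewrite ler_wpM2l ?mulr_ge0 ?ler_nat.
Qed.

Lemma sum_exprn_ratio_le (n a q : nat) : (1 < n)%N ->
  (a.*2 <= n)%N -> (n <= q + a)%N ->
  \sum_(3 <= l < n.+1) l%:R^-1 * (n%:R / q.+1%:R) ^+ l
    <= ln n%:R * expR (2 * a%:R) :> R.
Proof.
move=> n_gt1 a_le n_le.
have sum_inv_le : \sum_(3 <= l < n.+1) l%:R^-1 <= ln n%:R :> R.
  apply: le_trans (@sum_inv_le_ln 2 n n_gt1) _.
  by rewrite lerBlDr lerDl ln_ge0 ?ler1n.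
apply: le_trans (ler_wpM2r (expR_ge0 _) sum_inv_le).
rewrite mulr_suml; apply: ler_sum_nat => l /andP[_ l_le].
by rewrite ler_wpM2l ?invr_ge0 // exprn_ratio_le.
Qed.

Lemma expR1_ge2 : 2 <= expR 1 :> R.
Proof. by have := expR_ge1Dx (1 : R); lra. Qed.

Lemma ln_ge x y : expR x <= y -> x <= ln y.
Proof.
move=> y_ge; rewrite -[x]expRK ler_ln ?posrE ?expR_gt0 //.
exact: lt_le_trans (expR_gt0 x) y_ge.
Qed.

Lemma le_mul_div_ln (K y : R) : 0 <= K -> expR 1 <= y -> K <= K * y / ln y.
Proof.
move=> K_ge0 y_ge.
have y_gt0 : 0 < y := lt_le_trans (expR_gt0 1) y_ge.
have ln_y_gt0 : 0 < ln y := lt_le_trans ltr01 (ln_ge y_ge).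
by rewrite ler_pdivlMr // ler_wpM2l // ltW // ln_sublinear.
Qed.

(* Up to a constant, z |-> z / ln z and x |-> x ln x are mutually inverse. *)
Lemma mul_ln_ge (K x y : R) : expR 2 <= K -> expR 1 <= y ->
  K * y / ln y <= x -> K / 2 * y <= x * ln x.
Proof.
move=> K_ge y_ge x_ge.
have ln_y_gt0 : 0 < ln y := lt_le_trans ltr01 (ln_ge y_ge).
have K_gt0 : 0 < K := lt_le_trans (expR_gt0 2) K_ge.
have y_gt0 : 0 < y := lt_le_trans (expR_gt0 1) y_ge.
have bound_gt0 : 0 < K * y / ln y by rewrite divr_gt0 ?mulr_gt0.
have ln_K_ge2 := ln_ge K_ge.
have ln_ln_y_le : ln (ln y) <= ln y / 2 + 2.
  rewrite -{1}[ln y](divfK (_ : 2 != 0)) // lnM ?posrE ?divr_gt0 //.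
  by rewrite lerD ?ltW ?ln_sublinear ?divr_gt0.
have ln_x_ge : ln y / 2 <= ln x.
  apply: (@le_trans _ _ (ln (K * y / ln y))).
    by rewrite ln_div ?lnM ?posrE ?mulr_gt0 //; lra.
  by rewrite ler_ln ?posrE // (lt_le_trans bound_gt0).
have -> : K / 2 * y = (K * y / ln y) * (ln y / 2) by field; rewrite lt0r_neq0.
by apply: ler_pM => //; rewrite ltW // divr_gt0.
Qed.

Lemma ln_fact_sub2_ge t : expR 8 <= t%:R :> R ->
  3 / 8 * (t%:R * ln t%:R) <= ln (t - 2)`!%:R :> R.
Proof.
move=> t_ge; have expR8_ge := expR_ge1Dx (8 : R).
have t_gt2 : (2 < t)%N by rewrite -(ltr_nat R); lra.
have ln_t_ge8 := ln_ge t_ge.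
apply: le_trans (ln_fact_ge (t - 2)); rewrite natrB 1?ltnW //.
have ln_sub2_ge : ln t%:R - 1 <= ln (t%:R - 2) :> R.
  rewrite lerBlDr -[X in _ + X]expRK -lnM ?posrE ?expR_gt0 //; last by lra.
  by rewrite ler_ln ?posrE; have := expR1_ge2; nra.
have -> : 3 / 8 * (t%:R * ln t%:R) = (t%:R / 2) * (3 / 4 * ln t%:R) :> R.
  by field.
by apply: ler_pM; lra.
Qed.

Lemma mul_expR_lt_fact_sub2 (x a : R) t : expR 1 <= ln x -> 0 < x ->
  expR 8 * ln x / ln (ln x) <= t%:R -> a < 16^-1 * t%:R * ln t%:R ->
  x * expR (2 * a) < (t - 2)`!%:R.
Proof.
move=> ln_x_ge x_gt0 t_ge a_lt; have expR8_ge := expR_ge1Dx (8 : R).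
have t_ge_expR8 := le_trans (le_mul_div_ln (expR_ge0 8) ln_x_ge) t_ge.
have ln_x_le : 9 / 2 * ln x <= t%:R * ln t%:R.
  apply: le_trans (mul_ln_ge _ ln_x_ge t_ge); last by rewrite ler_expR; lra.
  by rewrite ler_wpM2r //; have := expR_gt0 (1 : R); lra.
have fact_gt0R : 0 < (t - 2)`!%:R :> R by rewrite ltr0n fact_gt0.
rewrite -ltr_ln ?posrE ?mulr_gt0 ?expR_gt0 // lnM ?posrE ?expR_gt0 // expRK.
apply: lt_le_trans (ln_fact_sub2_ge t_ge_expR8).
have := expR_gt0 (1 : R); rewrite -mulrA in a_lt; lra.
Qed.

Lemma client_avoids_large_complete_minor (n t a q : nat) :
  expR (expR 1) <= ln n%:R :> R ->
  expR 8 * ln (ln n%:R) / ln (ln (ln n%:R)) <= t%:R :> R ->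
  a%:R < 16^-1 * t%:R * ln t%:R :> R -> (a.*2 <= n)%N -> (n <= q + a)%N ->
  client_has_winning_strategy (complete_edges n) (minor_family n t) q.
Proof.
move=> ln_n_ge t_ge a_lt a_le n_le.
have ln_n_gt0 : 0 < ln n%:R :> R := lt_le_trans (expR_gt0 _) ln_n_ge.
have lnln_n_ge := ln_ge ln_n_ge.
have t_gt2 : (2 < t)%N.
  rewrite -(ltr_nat R); have := expR_ge1Dx (8 : R).
  by have := le_trans (le_mul_div_ln (expR_ge0 8) lnln_n_ge) t_ge; lra.
have n_gt1 : (1 < n)%N.
  rewrite ltnNge; apply: contraTN ln_n_gt0 => n_le1.
  by rewrite -leNgt ln_le0 ?lern1.
apply: (@client_avoids_complete_minor R) => //.
apply: le_lt_trans (sum_exprn_ratio_le n_gt1 a_le n_le) _.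
exact: mul_expR_lt_fact_sub2.
Qed.

End LogarithmicBounds.

Local Open Scope classical_set_scope.

Theorem theorem1p2 (R : realType) :
  exists C c : R, 0 < C /\ 0 < c /\
    forall t alpha : nat -> nat,
      (\forall n \near \oo,
         C * ln (ln n%:R) / ln (ln (ln n%:R)) <= (t n)%:R) ->
      (\forall n \near \oo, (alpha n)%:R < c * (t n)%:R * ln (t n)%:R) ->
      (fun n : nat => (alpha n)%:R : R) =o_\oo (fun n : nat => n%:R : R) ->
      \forall n \near \oo, forall q : nat,
        n%:Z - (alpha n)%:Z <= q%:Z ->
        client_has_winning_strategy (complete_edges n) (minor_family n (t n)) q.
Proof.
exists (expR 8), 16^-1; split; [exact: expR_gt0 | split; first by lra].
move=> t alpha t_ge alpha_lt /eqoP/(_ (2^-1) ltac:(lra)) alpha_o.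
near=> n => q q_ge.
have alpha_le : ((alpha n).*2 <= n)%N.
  have : `|(alpha n)%:R| <= 2^-1 * `|n%:R| :> R by near: n.
  by rewrite !ger0_norm // -mul2n -(ler_nat R) natrM; lra.
apply: (@client_avoids_large_complete_minor R _ _ (alpha n)) => //.
- by apply: ln_ge; near: n; exact: nbhs_infty_ger.
- by near: n.
- by near: n.
- by lia.
Unshelve. all: by end_near. Qed.
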